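(* Let $n\ge1$, $a,b\in\mathbb{C}$ and $C(\partial)\in\mathbb{C}[\partial]^{n\times n}$. The generalized conformal module $V_{a,b,C(\partial)}$ over $Vir$ is irreducible if and only if $a\neq0$ and $\frac{d}{d\partial}+C(\partial)$ acts irreducibly on $\mathbb{C}(\partial)^n$. Moreover, the following statements are equivalent: (a) $\frac{d}{d\partial}+C(\partial)$ acts irreducibly on $\mathbb{C}(\partial)^n$; (b) for any $1\le r<n$ and any $B(x)\in\mathbb{C}(x)^{r\times r}$, the equation $Y'(x)+C(x)Y(x)=Y(x)B(x)$ has no nonzero solutions $Y(x)\in\mathbb{C}(x)^{n\times r}$; (c) any nonzero $W_1$-submodule of $V_{a,b,C(\partial)}$ is of rank $n$ as a $\mathbb{C}[x]$-module (writing $x$ for the variable $\partial$).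
   Context: The Virasoro conformal algebra is $Vir=\mathbb{C}[\partial]L$ with $[L_\lambda L]=(\partial+2\lambda)L$. A generalized conformal module $V$ over $Vir$ is a $\mathbb{C}[\partial]$-module with a linear map $L_\lambda:V\to V[[\lambda]]$ such that $L_\lambda(\partial v)=(\partial+\lambda)L_\lambda v$ and $L_\lambda(L_\mu v)-L_\mu(L_\lambda v)=(\lambda-\mu)L_{\lambda+\mu}v$ for all $v\in V$. A submodule is a $\mathbb{C}[\partial]$-submodule $W$ with $L_\lambda W\subseteq W[[\lambda]]$; $V$ is irreducible if $V\ne0$ and its only submodules are $0$ and $V$. $V_{a,b,C(\partial)}$: the free $\mathbb{C}[\partial]$-module $\mathbb{C}[\partial]^n$ with the action $$L_\lambda\mathbf{f}(\partial)=(\partial+a\lambda+b)e^{\lambda\mathcal{L}}\mathbf{f}(\partial)=\sum_{k\ge0}\frac{\lambda^k}{k!}\big((\partial+b)\mathcal{L}^k+ka\mathcal{L}^{k-1}\big)\mathbf{f}(\partial),$$ where $\mathcal{L}=\frac{d}{d\partial}+C(\partial)$ acts on column vectors by $\mathcal{L}\mathbf{f}=\mathbf{f}'+C(\partial)\mathbf{f}$. This is a generalized conformal module over $Vir$. $\mathcal{L}$ extends to $\mathbb{C}(\partial)^n$ by the same formula; it acts irreducibly on $\mathbb{C}(\partial)^n$ if the only $\mathbb{C}(\partial)$-subspaces $U$ with $\mathcal{L}U\subseteq U$ are $0$ and $\mathbb{C}(\partial)^n$. $W_1=\bigoplus_{i\ge-1}\mathbb{C}L_i$ is the Lie algebra with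 $[L_i,L_j]=(i-j)L_{i+j}$; it acts on $V_{a,b,C(\partial)}=\mathbb{C}[x]^n$ (writing $x$ for $\partial$) by $L_k=(x+b)\mathcal{L}^{k+1}+(k+1)a\mathcal{L}^k$ for $k\ge-1$; in particular $L_{-1}$ acts as multiplication by $x+b$, so $W_1$-submodules are $\mathbb{C}[x]$-submodules. *)

(* Defs.v *)
From HB Require Import structures.
From mathcomp Require Import all_boot all_order all_algebra.
From mathcomp Require Import ring.
From mathcomp Require Import classical_sets.

Set Implicit Arguments.
Unset Strict Implicit.
Unset Printing Implicit Defensive.

Import Order.TTheory GRing.Theory Num.Theory.
Local Open Scope ring_scope.

(* A series s : nat -> V stands for \sum_k s k lambda^k, and
   s : nat -> nat -> V for \sum_(i, j) s i j lambda^i mu^j. *)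
Section FormalSeries.
Variable V : zmodType.

Definition mul_var (s : nat -> V) : nat -> V :=
  fun k => if k is k'.+1 then s k' else 0.

Definition mul_lam (s : nat -> nat -> V) : nat -> nat -> V :=
  fun i j => if i is i'.+1 then s i' j else 0.

Definition mul_mu (s : nat -> nat -> V) : nat -> nat -> V :=
  fun i j => if j is j'.+1 then s i j' else 0.

(* the substitution lambda := lambda + mu *)
Definition subst_add (s : nat -> V) : nat -> nat -> V :=
  fun i j => s (i + j)%N *+ 'C(i + j, i).

End FormalSeries.

(* Generalized conformal modules over Vir = K[d]L; the indeterminate 'X of
   {poly K} is the derivation d, and gcm_act v is the series L_lambda v. *)
Structure gcmodule (K : fieldType) := GCModule {
  gcm_sort :> lmodType {poly K};
  gcm_act : gcm_sort -> nat -> gcm_sort;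
  gcm_linear : forall (c : K) (u v : gcm_sort) (k : nat),
    gcm_act (c%:P *: u + v) k = c%:P *: gcm_act u k + gcm_act v k;
  gcm_sesqui : forall (v : gcm_sort) (k : nat),
    gcm_act ('X *: v) k = 'X *: gcm_act v k + mul_var (gcm_act v) k;
  gcm_jacobi : forall (v : gcm_sort) (i j : nat),
    gcm_act (gcm_act v j) i - gcm_act (gcm_act v i) j =
    let s := subst_add (gcm_act v) in mul_lam s i j - mul_mu s i j }.

Definition gcm_submodule (K : fieldType) (V : gcmodule K) (W : set V) : Prop :=
  [/\ W 0,
      forall u v, W u -> W v -> W (u + v),
      forall (p : {poly K}) v, W v -> W (p *: v)
    & forall v k, W v -> W (gcm_act v k)].

Definition gcm_irreducible (K : fieldType) (V : gcmodule K) : Prop :=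
  (exists v : V, v != 0) /\
  (forall W : set V, gcm_submodule W -> W = [set 0]%classic \/ W = setT).

(* D plays the part of d/dx, acting entrywise. *)
Definition connection (A : nzRingType) (D : A -> A) n (C : 'M[A]_n)
  (f : 'cV[A]_n) : 'cV[A]_n := map_mx D f + C *m f.

Section PolyModule.
Variables (K : numFieldType) (n : nat) (a b : K) (C : 'M[{poly K}]_n).

Local Notation LC := (connection (@deriv K) C).

(* W1_act a b C k is the action of the basis element L_(k-1) of W_1; for k = 0
   the second term vanishes. *)
Definition W1_act (k : nat) (f : 'cV[{poly K}]_n) : 'cV[{poly K}]_n :=
  ('X + b%:P) *: iter k LC f + (k%:R * a)%:P *: iter k.-1 LC f.

Definition W1_submodule (W : set 'cV[{poly K}]_n) : Prop :=
  [/\ W 0,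
      forall f g, W f -> W g -> W (f + g),
      forall (c : K) f, W f -> W (c%:P *: f)
    & forall k f, W f -> W (W1_act k f)].

Definition Vabc_act (f : 'cV[{poly K}]_n) (k : nat) : 'cV[{poly K}]_n :=
  (k`!%:R^-1)%:P *: W1_act k f.

Lemma connection_deriv_linear (c : K) f g :
  LC (c%:P *: f + g) = c%:P *: LC f + LC g.
Proof.
rewrite /connection mulmxDr -scalemxAr scalerDr addrACA; congr (_ + _).
by apply/matrixP=> i j; rewrite !mxE derivD derivM derivC mul0r add0r.
Qed.

Lemma connection_derivM (p : {poly K}) f : LC (p *: f) = p^`() *: f + p *: LC f.
Proof.
rewrite /connection -scalemxAr scalerDr addrA; congr (_ + _).
by apply/matrixP=> i j; rewrite !mxE derivM.
Qed.

Lemma iter_connection_linear k (c : K) f g :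
  iter k LC (c%:P *: f + g) = c%:P *: iter k LC f + iter k LC g.
Proof. by elim: k => //= k ->; rewrite connection_deriv_linear. Qed.

Lemma iter_connectionX (c : K) k f : iter k LC (('X + c%:P) *: f) =
  ('X + c%:P) *: iter k LC f + k%:R *: iter k.-1 LC f.
Proof.
elim: k => [|k IH] /=; first by rewrite scale0r addr0.
rewrite IH addrC -[k%:R]polyC_natr connection_deriv_linear connection_derivM.
rewrite derivD derivX derivC addr0 polyC_natr.
case: k {IH} => [|k] /=; set g := connection _ _ _; last set h := connection _ _ _.
  by apply/matrixP=> r s; rewrite !mxE; ring.
by apply/matrixP=> r s; rewrite !mxE; ring.
Qed.

Lemma W1_act_linear k (c : K) f g :
  W1_act k (c%:P *: f + g) = c%:P *: W1_act k f + W1_act k g.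
Proof.
rewrite /W1_act !iter_connection_linear !scalerDr !scalerA.
by rewrite [_ * c%:P]mulrC [_%:P * c%:P]mulrC addrACA.
Qed.

Lemma W1_actX k f :
  W1_act k ('X *: f) = 'X *: W1_act k f + k%:R *: W1_act k.-1 f.
Proof.
have eX j : iter j LC ('X *: f) = 'X *: iter j LC f + j%:R *: iter j.-1 LC f.
  by have := iter_connectionX 0 j f; rewrite polyC0 addr0.
rewrite /W1_act !eX; apply/matrixP=> i j; rewrite !mxE.
case: k => [|[|k]] /=; rewrite ?polyCM ?polyC_natr; by ring.
Qed.

(* [L_(i-1), L_(j-1)] = (i - j) L_(i+j-2) *)
Lemma W1_act_bracket i j f : W1_act i (W1_act j f) - W1_act j (W1_act i f) =
  (i%:R - j%:R) *: W1_act (i + j).-1 f.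
Proof.
have itD k l : iter k LC (W1_act l f) =
    ('X + b%:P) *: iter (k + l) LC f + k%:R *: iter (k.-1 + l) LC f +
    (l%:R * a)%:P *: iter (k + l.-1) LC f.
  by rewrite {1}/W1_act addrC iter_connection_linear iter_connectionX -!iterD
    addrC.
rewrite {1 3}/W1_act !itD /W1_act; apply/matrixP=> r s; rewrite !mxE.
case: i j => [|[|i]] [|[|j]]; rewrite /= ?addn0 ?add0n ?addSn ?addnS ?addn0 /=
  ?[(j + i)%N]addnC ?polyCM ?polyC_natr; by ring.
Qed.

Lemma Vabc_act_linear (c : K) (u v : 'cV[{poly K}]_n) k :
  Vabc_act (c%:P *: u + v) k = c%:P *: Vabc_act u k + Vabc_act v k.
Proof.
by rewrite /Vabc_act W1_act_linear scalerDr !scalerA mulrC.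
Qed.

Lemma Vabc_act_sesqui (v : 'cV[{poly K}]_n) k :
  Vabc_act ('X *: v) k = 'X *: Vabc_act v k + mul_var (Vabc_act v) k.
Proof.
rewrite /Vabc_act W1_actX scalerDr !scalerA [_ * 'X]mulrC; congr (_ + _).
case: k => [|k] /=; first by rewrite mulr0 scale0r.
have e : k.+1`!%:R^-1 * k.+1%:R = k`!%:R^-1 :> K.
  by rewrite factS natrM invfM mulrAC mulVf ?mul1r // pnatr_eq0.
by rewrite -polyC_natr -polyCM e.
Qed.

Lemma Vabc_act_jacobi (v : 'cV[{poly K}]_n) i j :
  Vabc_act (Vabc_act v j) i - Vabc_act (Vabc_act v i) j =
  let s := subst_add (Vabc_act v) in mul_lam s i j - mul_mu s i j.
Proof.
have fN0 m : m`!%:R != 0 :> K by rewrite pnatr_eq0 -lt0n fact_gt0.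
have actZ k (c : K) f : W1_act k (c%:P *: f) = c%:P *: W1_act k f.
  have W0 : W1_act k 0 = 0.
    have := W1_act_linear k (-1) 0 0.
    by rewrite scaler0 addr0 polyCN scaleN1r addNr.
  by have := W1_act_linear k c f 0; rewrite addr0 W0 addr0.
have binE m l : (m + l)`!%:R^-1 *+ 'C(m + l, m) = m`!%:R^-1 * l`!%:R^-1 :> K.
  have := bin_fact (leq_addr l m); rewrite addKn => /(congr1 (fun t => t%:R : K)).
  rewrite !natrM => e; rewrite -[LHS]mulr_natr.
  apply: (mulfI (fN0 (m + l)%N)); rewrite mulrA mulfV // mul1r -e.
  by field; rewrite !fN0.
have sE m l : subst_add (Vabc_act v) m l =
    (m`!%:R^-1 * l`!%:R^-1)%:P *: W1_act (m + l) v.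
  by rewrite /subst_add /Vabc_act scalerMnl -polyCMn binE.
have facS k : k.+1%:R * k.+1`!%:R^-1 = k`!%:R^-1 :> K.
  by rewrite factS natrM invfM mulrA mulfV ?mul1r // pnatr_eq0.
have -> : Vabc_act (Vabc_act v j) i - Vabc_act (Vabc_act v i) j =
    ((i%:R - j%:R) * (i`!%:R^-1 * j`!%:R^-1))%:P *: W1_act (i + j).-1 v.
  rewrite /Vabc_act !actZ !scalerA -!polyCM [j`!%:R^-1 * _]mulrC -scalerBr.
  rewrite W1_act_bracket scalerA -!polyC_natr -polyCB -polyCM.
  by rewrite [_ * (i%:R - _)]mulrC.
rewrite mulrBl polyCB scalerBl.
congr (_ - _).
  case: i => [|i] /=; first by rewrite mul0r polyC0 scale0r.
  by rewrite sE mulrA facS.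
case: j => [|j] /=; first by rewrite mul0r polyC0 scale0r.
by rewrite sE addnS mulrCA facS.
Qed.

Definition Vabc : gcmodule K :=
  GCModule Vabc_act_linear Vabc_act_sesqui Vabc_act_jacobi.

End PolyModule.

(* d/dx on the fraction field, by the quotient rule on the representative
   chosen by {fraction _}; fderivE shows that the choice does not matter. *)
Definition fderiv (K : fieldType) (x : {fraction {poly K}}) :
    {fraction {poly K}} :=
  let p := \n_(repr x) in let q := \d_(repr x) in
  tofrac (p^`() * q - p * q^`()) / tofrac q ^+ 2.

Lemma frac_reprE (A : idomainType) (x : {fraction A}) :
  x = tofrac \n_(repr x) / tofrac \d_(repr x).
Proof.
rewrite -[LHS]reprK -[in LHS](Ratio_numden (repr x)).
case: (repr x) => -[p q] /= q0.
apply: (mulIf (x := tofrac q)); first by rewrite tofrac_eq0.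
rewrite divfK ?tofrac_eq0 //; unlock tofrac; rewrite -[LHS]FracField.pi_mul.
apply/eqmodP; rewrite /= FracField.equivfE /FracField.mulf /=.
by rewrite !numden_Ratio ?oner_eq0 ?mulf_neq0 ?oner_eq0 // !mulr1 mulrC.
Qed.

Lemma fderivE (K : fieldType) (p q : {poly K}) : q != 0 ->
  fderiv (tofrac p / tofrac q) =
  tofrac (p^`() * q - p * q^`()) / tofrac q ^+ 2.
Proof.
move=> q0; rewrite /fderiv.
set x := tofrac p / tofrac q.
have := frac_reprE x; have : \d_(repr x) != 0 := denom_ratioP _.
move: (\n_(repr x)) (\d_(repr x)) => r s s0.
have fN0 t : t != 0 -> tofrac t != 0 :> {fraction {poly K}}.
  by rewrite tofrac_eq0.
rewrite /x => /eqP; rewrite eqr_div ?fN0 // -!tofracM tofrac_eq => /eqP e.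
apply/eqP; rewrite -!tofracXn eqr_div ?fN0 ?expf_neq0 // -!tofracM tofrac_eq.
have := congr1 (@deriv K) e; rewrite !derivM => e'; apply/eqP; symmetry.
transitivity (q * s * (p^`() * s + p * s^`()) - p * s * (q * s^`() + q^`() * s)).
  by ring.
by rewrite e' e; ring.
Qed.

(* The K(x)-subspaces of K(x)^n are the {vspace _} of column vectors. *)
Definition acts_irreducibly (K : fieldType) n (C : 'M[{poly K}]_n) : Prop :=
  forall U : {vspace 'cV[{fraction {poly K}}]_n},
    (forall f, f \in U -> connection (@fderiv K) (map_mx (@tofrac _) C) f \in U) ->
    U = 0%VS \/ U = fullv.

Definition lin_indep (A : nzRingType) (V : lmodType A) m (v : 'I_m -> V) : Prop :=
  forall c : 'I_m -> A, \sum_(i < m) c i *: v i = 0 -> forall i, c i = 0.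

(* the maximal number of linearly independent elements *)
Definition has_rank (A : nzRingType) (V : lmodType A) (W : set V) (r : nat) : Prop :=
  (exists2 v : 'I_r -> V, (forall i, W (v i)) & lin_indep v) /\
  (forall m (v : 'I_m -> V), (forall i, W (v i)) -> lin_indep v -> (m <= r)%N).

(* Main.v *)
Require Import Defs.
From mathcomp Require Import all_boot all_order all_algebra.
From mathcomp Require Import ring.
From mathcomp Require Import boolp classical_sets reals complex.

Set Implicit Arguments.
Unset Strict Implicit.
Unset Printing Implicit Defensive.

Import GRing.Theory Num.Theory.
Local Open Scope ring_scope.

(* Write L = d/dx + C(x). L-stable subspaces U of K(x)^n and W_1-submodules W of
   K[x]^n are compared through the intersection of U with K[x]^n and the
   K(x)-span of W: since (x + b) L = L_0 - a, this span is L-stable.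
   For irreducibility with a != 0, a nonzero submodule W contains a nonzero
   K[x]-submodule W' stable under L. By irreducibility of L, W' has rank n, so
   p K[x]^n is contained in W' for some p != 0, for instance a determinant.
   Since [L, p] = p', the same holds for p', and in characteristic 0 one reaches
   a nonzero constant. *)

(** * The derivation d/dx on rational functions and on matrices of them *)

Section FractionDerivation.
Variable K : fieldType.
Local Notation F := {fraction {poly K}}.

Lemma fracP (A : idomainType) (x : {fraction A}) :
  exists p q : A, q != 0 /\ x = tofrac p / tofrac q.
Proof.
by exists \n_(repr x), \d_(repr x); split; [exact: denom_ratioP | exact: frac_reprE].
Qed.

Lemma fderiv_tofrac (p : {poly K}) : fderiv (tofrac p) = tofrac p^`().
Proof.
have := fderivE p (oner_neq0 _).
by rewrite tofrac1 expr1n !divr1 derivC mulr0 subr0 mulr1.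
Qed.

(** By [fderivE] any representatives may be used; clearing denominators then leaves a polynomial
    identity. *)
Lemma fderivD (x y : F) : fderiv (x + y) = fderiv x + fderiv y.
Proof.
have [p [q [q0 ->]]] := fracP x; have [r [s [s0 ->]]] := fracP y.
have tN0 t : t != 0 -> tofrac t != 0 :> F by rewrite tofrac_eq0.
have -> : tofrac p / tofrac q + tofrac r / tofrac s =
    tofrac (p * s + r * q) / tofrac (q * s) :> F.
  by rewrite tofracD !tofracM addf_div ?tN0.
rewrite !fderivE ?mulf_neq0 // -!tofracXn addf_div ?tN0 ?expf_neq0 //.
rewrite -!tofracM -tofracD; apply/eqP.
rewrite eqr_div ?tN0 ?mulf_neq0 ?expf_neq0 ?mulf_neq0 // -!tofracM tofrac_eq.
by rewrite derivD !derivM; apply/eqP; ring.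
Qed.

Lemma fderivM (x y : F) : fderiv (x * y) = fderiv x * y + x * fderiv y.
Proof.
have [p [q [q0 ->]]] := fracP x; have [r [s [s0 ->]]] := fracP y.
have tN0 t : t != 0 -> tofrac t != 0 :> F by rewrite tofrac_eq0.
rewrite mulf_div -!tofracM !fderivE ?mulf_neq0 // -!tofracXn !mulf_div.
rewrite -!tofracM addf_div ?tN0 ?mulf_neq0 ?expf_neq0 // -!tofracM -tofracD.
apply/eqP; rewrite eqr_div ?tN0 ?mulf_neq0 ?expf_neq0 ?mulf_neq0 //.
by rewrite -!tofracM tofrac_eq !derivM; apply/eqP; ring.
Qed.

Lemma fderiv0 : fderiv (0 : F) = 0.
Proof. by rewrite -tofrac0 fderiv_tofrac deriv0 tofrac0. Qed.

Lemma fderiv_sum m (f : 'I_m -> F) :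
  fderiv (\sum_i f i) = \sum_i fderiv (f i).
Proof. exact: (big_morph _ fderivD fderiv0). Qed.

Lemma map_fderivM m n r (Y : 'M[F]_(m, n)) (Z : 'M[F]_(n, r)) :
  map_mx (@fderiv K) (Y *m Z) =
  map_mx (@fderiv K) Y *m Z + Y *m map_mx (@fderiv K) Z.
Proof.
apply/matrixP=> i j; rewrite !mxE fderiv_sum -big_split /=.
by apply: eq_bigr => k _; rewrite !mxE fderivM.
Qed.

Lemma map_fderiv_tofrac m n (M : 'M[{poly K}]_(m, n)) :
  map_mx (@fderiv K) (map_mx (@tofrac _) M) = map_mx (@tofrac _) (map_mx (@deriv K) M).
Proof. by apply/matrixP=> i j; rewrite !mxE fderiv_tofrac. Qed.

End FractionDerivation.

(** The product of the denominators of all entries works. This moves vectors over the fraction field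
    back to [A]. *)
Lemma frac_mx_common_denom (A : idomainType) m n (f : 'M[{fraction A}]_(m, n)) :
  exists2 p : A, p != 0 & exists g : 'M[A]_(m, n),
    tofrac p *: f = map_mx (@tofrac _) g.
Proof.
pose d (ij : 'I_m * 'I_n) := \d_(repr (f ij.1 ij.2)).
exists (\prod_ij d ij).
  by apply/prodf_neq0=> ij _; apply: denom_ratioP.
exists (\matrix_(i, j) (\n_(repr (f i j)) * \prod_(ij | ij != (i, j)) d ij)).
apply/matrixP=> i j; rewrite !mxE (bigD1 (i, j)) //= !tofracM.
rewrite mulrAC; congr (_ * _).
have d0 : tofrac (d (i, j)) != 0 by rewrite tofrac_eq0; apply: denom_ratioP.
by apply: (mulIf (invr_neq0 d0)); rewrite mulrAC divff // mul1r -frac_reprE.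
Qed.

(** * Rank over a domain as dimension over its fraction field *)

Section RankOverFractions.
Variables (A : idomainType) (n : nat).
Local Notation V := 'cV[A]_n.
Local Notation F := {fraction A}.
Local Notation tf := (map_mx (@tofrac A)).

Lemma map_tofrac_inj m r : injective (tf : 'M_(m, r) -> 'M_(m, r)).
Proof.
move=> f g /matrixP e; apply/matrixP=> i j.
by have := e i j; rewrite !mxE => /eqP; rewrite tofrac_eq => /eqP.
Qed.

Lemma map_tofrac_sum m (c : 'I_m -> A) (v : 'I_m -> V) :
  tf (\sum_i c i *: v i) = \sum_i tofrac (c i) *: tf (v i).
Proof. by rewrite raddf_sum; apply: eq_bigr => i _; rewrite /= map_mxZ. Qed.

(** A relation over the fraction field becomes one over [A] once multiplied by a common denominator.
    Ranks can thus be computed as dimensions. *)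
Lemma lin_indep_free m (v : 'I_m -> V) :
  lin_indep v <-> free [tuple tf (v i) | i < m].
Proof.
set X := [tuple _ | _ < _].
have nX (i : 'I_m) : X`_i = tf (v i) by rewrite -tnth_nth tnth_mktuple.
split=> [vi|/freeP vf c c0 i].
  apply/freeP => k k0 i.
  have [p p0 [g /matrixP pg]] := frac_mx_common_denom (\col_i k i).
  have gE j : tofrac (g j 0) = tofrac p * k j by have := pg j 0; rewrite !mxE.
  suff : g i 0 = 0.
    move/(congr1 (@tofrac A)); rewrite gE tofrac0 => /eqP.
    by rewrite mulf_eq0 tofrac_eq0 (negPf p0) => /eqP.
  apply: (vi (fun j => g j 0)); apply: map_tofrac_inj.
  transitivity (tofrac p *: \sum_(j < m) k j *: X`_j); last by rewrite k0 scaler0 map_mx0.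
  rewrite map_tofrac_sum scaler_sumr.
  by apply: eq_bigr => j _; rewrite gE nX scalerA.
apply/eqP; rewrite -tofrac_eq0; apply/eqP.
apply: (vf (fun j => tofrac (c j))).
transitivity (tf (\sum_j c j *: v j)); last by rewrite c0 map_mx0.
by rewrite map_tofrac_sum; apply: eq_bigr => j _; rewrite nX.
Qed.

Lemma lin_indep_leq m (v : 'I_m -> V) : lin_indep v -> (m <= n)%N.
Proof.
move/lin_indep_free; rewrite /free size_tuple => /eqP <-.
by have := dimvS (subvf <<[tuple tf (v i) | i < m]>>%VS); rewrite dimvf /dim /= muln1.
Qed.

(** An independent family in [W] of maximal length, which exists by the bound [n], must span: a
    vector outside the span could be prepended to it. *)
Lemma frac_span (W : set V) :
  exists m (v : 'I_m -> V), [/\ forall i, W (v i), lin_indep v &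
    forall w, W w -> tf w \in <<[tuple tf (v i) | i < m]>>%VS].
Proof.
pose P m := `[< exists2 v : 'I_m -> V, forall i, W (v i) & lin_indep v >].
have exP : exists m, P m.
  by exists 0%N; apply/asboolP; exists (fun=> 0) => [|c _] [].
have ubP m : P m -> (m <= n)%N.
  by case/asboolP=> v _; apply: lin_indep_leq.
case: (ex_maxnP exP ubP) => m /asboolP[v Wv vi] maxm.
exists m, v; split=> // w Ww; apply/negPn/negP=> wX.
suff /maxm : P m.+1 by rewrite ltnn.
apply/asboolP; exists (fun i => oapp v w (unlift ord0 i)) => [i|].
  by case: (unliftP ord0 i) => [j _|_] /=; [apply: Wv | apply: Ww].
apply/lin_indep_free.
set Y := [tuple _ | _ < _].
have -> : Y = [tuple of tf w :: [tuple tf (v i) | i < m]].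
  apply: eq_from_tnth=> i; rewrite tnth_mktuple /=.
  case: (unliftP ord0 i) => [j ->|->] /=; last by rewrite tnth0.
  by rewrite tnthS tnth_mktuple.
by rewrite free_cons wX; apply/lin_indep_free.
Qed.

End RankOverFractions.

(** * The operator L over K[x] and K(x), and its stable subspaces *)

Section Connection.
Variables (K : numFieldType) (n : nat) (C : 'M[{poly K}]_n).
Local Notation P := {poly K}.
Local Notation F := {fraction {poly K}}.
Local Notation V := 'cV[P]_n.
Local Notation tf := (map_mx (@tofrac P)).
Local Notation LC := (connection (@deriv K) C).
Local Notation LF := (connection (@fderiv K) (tf C)).

Lemma connection_tofrac (f : V) : LF (tf f) = tf (LC f).
Proof. by rewrite /connection map_fderiv_tofrac map_mxD map_mxM. Qed.

Lemma connection_fderivD (f g : 'cV[F]_n) : LF (f + g) = LF f + LF g.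
Proof.
rewrite /connection mulmxDr addrACA; congr (_ + _).
by apply/matrixP=> i j; rewrite !mxE fderivD.
Qed.

Lemma connection_fderivZ (c : F) (f : 'cV[F]_n) :
  LF (c *: f) = fderiv c *: f + c *: LF f.
Proof.
rewrite /connection -scalemxAr scalerDr addrA; congr (_ + _).
by apply/matrixP=> i j; rewrite !mxE fderivM.
Qed.

Lemma connection_fderiv0 : LF 0 = 0.
Proof.
by rewrite /connection mulmx0 addr0; apply/matrixP=> i j; rewrite !mxE fderiv0.
Qed.

(** L is only a derivation over K(x), but the extra term [fderiv c *: f] of the Leibniz rule stays
    in the span, so checking generators suffices. *)
Lemma connection_fderiv_span m (X : m.-tuple 'cV[F]_n) :
  (forall i : 'I_m, LF X`_i \in <<X>>%VS) ->
  forall f, f \in <<X>>%VS -> LF f \in <<X>>%VS.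
Proof.
move=> LX f /coord_span ->.
rewrite (big_morph _ connection_fderivD connection_fderiv0).
apply: rpred_sum => i _; rewrite connection_fderivZ rpredD ?rpredZ //.
by rewrite memv_span ?mem_nth ?size_tuple.
Qed.

(** The column space of a solution [Y] is L-stable of dimension at most r < n. Conversely, a basis
    of a stable subspace, written as columns, solves the equation with [B] the matrix of L in that
    basis. *)
Lemma acts_irreducibly_mxP : acts_irreducibly C <->
  (forall r : nat, (1 <= r < n)%N -> forall (B : 'M[F]_r) (Y : 'M[F]_(n, r)),
     map_mx (@fderiv K) Y + tf C *m Y = Y *m B -> Y = 0).
Proof.
split=> [irr r /andP[r0 rn] B Y eqY | noY U stU].
  pose f : {linear 'cV[F]_r -> 'cV[F]_n} := mulmx Y.
  pose U := limg (linfun f).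
  have memU g : Y *m g \in U.
    by rewrite -[Y *m g]/(f g) -(lfunE f) memv_img ?memvf.
  have [_ /memv_imgP[g _ ->]|U0|UT] := irr U.
  (* The equation gives L(Y g) = Y (B g + g'). *)
  - rewrite lfunE /= /connection map_fderivM mulmxA addrAC -mulmxDl eqY.
    by rewrite -mulmxA -mulmxDr memU.
  - apply/matrixP=> i j.
    have := memU (delta_mx j 0); rewrite U0 memv0 => /eqP/matrixP/(_ i 0).
    by rewrite -colE !mxE.
  (* Rank-nullity: a surjection from dimension r would force n <= r. *)
  - have := limg_ker_dim (linfun f) fullv.
    rewrite -/U UT !dimvf /dim /= !muln1 => e.
    by have : (n <= r)%N; [rewrite -e leq_addl | rewrite leqNgt rn].
have [->|U0] := eqVneq U 0%VS; first by left.
have [Un|Un] := leqP n (\dim U).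
  by right; apply/eqP; rewrite eqEdim subvf dimvf /dim /= muln1.
have r0 : (0 < \dim U)%N by rewrite lt0n dimv_eq0.
pose X := vbasis U.
pose Y : 'M[F]_(n, \dim U) := \matrix_(i, j) X`_j i 0.
pose B : 'M[F]_(\dim U) := \matrix_(i, j) coord X i (LF X`_j).
have XU (j : 'I_(\dim U)) : X`_j \in U.
  by apply: (basis_mem (vbasisP U)); rewrite mem_nth ?size_tuple.
have Y0 : Y = 0.
  apply: (noY (\dim U) _ B); first by rewrite r0.
  apply/matrixP=> i j; have /matrixP/(_ i 0) := coord_vbasis (stU _ (XU j)).
  rewrite summxE !mxE => e.
  transitivity (connection (@fderiv K) (tf C) X`_j i 0).
    by rewrite !mxE; congr (_ + _); apply: eq_bigr => k _; rewrite !mxE.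
  by rewrite !mxE e; apply: eq_bigr => k _; rewrite !mxE mulrC.
(* The first basis vector of the nonzero [U] would be the first column of [Y], hence zero. *)
have := basis_not0 (vbasisP U) (mem_nth 0 (_ : 0 < size X)%N).
rewrite size_tuple => /(_ r0) /eqP[]; apply/matrixP=> i j.
by have /matrixP/(_ i (Ordinal r0)) := Y0; rewrite !mxE ord1.
Qed.

(** * K[x]-submodules of K[x]^n: contraction, determinants, stability under L *)

Definition poly_submodule (W : set V) : Prop :=
  [/\ W 0, forall f g, W f -> W g -> W (f + g)
    & forall (p : P) f, W f -> W (p *: f)].

Lemma poly_submodule_contraction (U : {vspace 'cV[F]_n}) :
  poly_submodule [set f | tf f \in U]%classic.
Proof.
split=> [|f g /= fU gU|p f /= fU]; first by rewrite /= map_mx0 mem0v.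
  by rewrite map_mxD memvD.
by rewrite map_mxZ memvZ.
Qed.

Lemma contraction_neq0 (U : {vspace 'cV[F]_n}) : U != 0%VS ->
  exists2 f : V, tf f \in U & f != 0.
Proof.
rewrite -vpick0 => u0.
have [p p0 [g pg]] := frac_mx_common_denom (vpick U).
exists g; first by rewrite -pg memvZ ?memv_pick.
apply: contra_neq u0 => g0; apply/eqP.
have /eqP := pg; rewrite g0 map_mx0 scaler_eq0 tofrac_eq0.
by rewrite (negPf p0).
Qed.

Lemma lin_indep_span_full (v : 'I_n -> V) :
  lin_indep v -> <<[tuple tf (v i) | i < n]>>%VS = fullv.
Proof.
move/lin_indep_free; rewrite /free size_tuple => /eqP e.
by apply/eqP; rewrite eqEdim subvf dimvf /dim /= muln1 e leqnn.
Qed.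

Lemma iter_connection_derivX k f :
  iter k LC ('X *: f) = 'X *: iter k LC f + k%:R *: iter k.-1 LC f.
Proof. by have := iter_connectionX C 0 k f; rewrite polyC0 addr0. Qed.

Lemma poly_submodule_of_X (W : set V) :
  W 0 -> (forall f g, W f -> W g -> W (f + g)) ->
  (forall (c : K) f, W f -> W (c%:P *: f)) ->
  (forall f, W f -> W ('X *: f)) -> poly_submodule W.
Proof.
move=> W0 WD WC WX; split=> // p f Wf.
elim/poly_ind: p => [|p c IH]; first by rewrite scale0r.
by rewrite scalerDl mulrC -scalerA; apply: WD; [apply: WX | apply: WC].
Qed.

(** Let [M] have columns [v i]. Independence makes its determinant nonzero, and
    [M *m \adj M = (\det M)%:M] expresses each [\det M *: f] through the columns. *)
Lemma poly_submodule_det (W : set V) (v : 'I_n -> V) :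
  poly_submodule W -> (forall i, W (v i)) -> lin_indep v ->
  exists2 p : P, p != 0 & forall f, W (p *: f).
Proof.
move=> [W0 WD WZ] Wv vi; pose M : 'M[P]_n := \matrix_(i, j) v j i 0.
exists (\det M) => [|f].
  (* A row vector killed by the transpose of [M] is a linear relation among the [v i]. *)
  rewrite -det_tr; apply/det0P => -[u /eqP u0 uM]; apply: u0.
  apply/matrixP=> i j; rewrite ord1 mxE; apply: (vi (u 0)).
  apply/matrixP=> k l; have /matrixP/(_ 0 k) := uM.
  rewrite summxE !mxE => e; rewrite -[RHS]e.
  by apply: eq_bigr => j' _; rewrite !mxE ord1.
have -> : \det M *: f = \sum_j (\adj M *m f) j 0 *: v j.
  rewrite -mul_scalar_mx -mul_mx_adj -mulmxA.
  apply/matrixP=> i j; rewrite summxE ord1 mxE.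
  by apply: eq_bigr => k _; rewrite [in RHS]mxE [M _ _]mxE mulrC.
by apply: big_ind => // j _; apply: WZ.
Qed.

(* If pV is contained in W, then so is p'V, because p' f = L(p f) - p (L f). *)
Lemma stable_poly_submodule_full (W : set V) :
  poly_submodule W -> (forall f, W f -> W (LC f)) ->
  forall p : P, p != 0 -> (forall f, W (p *: f)) -> forall f, W f.
Proof.
move=> [W0 WD WZ] WL p; move: {2}(size p) (leqnn (size p)) => m.
elim: m p => [|m IH] p; first by rewrite leqn0 size_poly_eq0 => ->.
move=> sp p0 Wp; have [p1|p1] := leqP (size p) 1.
  move=> f; have [c pE] : exists c, p = c%:P by exists p`_0; apply: size1_polyC.
  have c0 : c != 0 by rewrite -polyC_eq0 -pE.
  have := WZ (c^-1)%:P _ (Wp f).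
  by rewrite pE scalerA -polyCM mulVf // scale1r.
apply: (IH p^`()).
- by rewrite -ltnS (leq_trans _ sp) // lt_size_deriv.
(* In characteristic 0 the leading coefficient of a nonconstant [p] survives in p', multiplied by
   the degree. *)
- have szp : (size p).-2.+1 = (size p).-1 by case: (size p) p1 => [|[]].
  have : p^`()`_(size p).-2 != 0.
    rewrite coef_deriv -mulr_natr mulf_neq0 ?pnatr_eq0 //.
    by rewrite szp -lead_coefE lead_coef_eq0.
  by apply: contra_neq => ->; rewrite coef0.
move=> f; have -> : p^`() *: f = LC (p *: f) + (-1) *: (p *: LC f).
  by rewrite connection_derivM scaleN1r addrK.
by apply: WD; [apply: WL | apply: WZ].
Qed.

End Connection.

(** * Submodules over W_1 and over Vir, and the irreducibility criterion *)

Section VirasoroModule.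
Variables (K : numFieldType) (n : nat) (a b : K) (C : 'M[{poly K}]_n).
Local Notation P := {poly K}.
Local Notation F := {fraction {poly K}}.
Local Notation V := 'cV[P]_n.
Local Notation tf := (map_mx (@tofrac P)).
Local Notation LC := (connection (@deriv K) C).
Local Notation LF := (connection (@fderiv K) (tf C)).
Local Notation act := (W1_act a b C).

Lemma XaddC_neq0 : 'X + b%:P != 0.
Proof. by rewrite -size_poly_eq0 size_XaddC. Qed.

(** [act 0] is multiplication by x + b; subtracting b recovers multiplication by x. *)
Lemma W1_submodule_poly (W : set V) : W1_submodule a b C W -> poly_submodule W.
Proof.
move=> [W0 WD WC WA]; apply: poly_submodule_of_X => // f Wf.
have -> : 'X *: f = act 0 f + (- b)%:P *: f.
  by rewrite /W1_act mul0r polyC0 scale0r addr0 -scalerDl polyCN addrK.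
by apply: WD; [apply: WA | apply: WC].
Qed.

Lemma W1_submodule_stable (W : set V) :
  poly_submodule W -> (forall f, W f -> W (LC f)) -> W1_submodule a b C W.
Proof.
move=> [W0 WD WZ] WL; split=> // [c f|k f] Wf; first exact: WZ.
have Wit j : W (iter j LC f) by elim: j => //= j; apply: WL.
by apply: WD; apply: WZ.
Qed.

(** The coefficient of lambda^k is [act k] divided by k!, which is invertible in characteristic
    0. *)
Lemma gcm_submoduleP (W : set V) :
  gcm_submodule (V := Vabc a b C) W <-> W1_submodule a b C W.
Proof.
split=> [[W0 WD WZ WA]|sW].
  split=> // [c f|k f] Wf; first exact: WZ.
  have -> : act k f = k`!%:R%:P *: Vabc_act a b C f k.
    rewrite /Vabc_act scalerA -polyCM divff ?scale1r //.
    by rewrite pnatr_eq0 -lt0n fact_gt0.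
  by apply: WZ; apply: WA.
have [W0 WD WZ] := W1_submodule_poly sW; have [_ _ WC WA] := sW.
by split=> // f k Wf; apply: WC; apply: WA.
Qed.

Lemma W1_submodule_contraction (U : {vspace 'cV[F]_n}) :
  (forall f, f \in U -> LF f \in U) ->
  W1_submodule a b C [set f | tf f \in U]%classic.
Proof.
move=> stU; apply: W1_submodule_stable; first exact: poly_submodule_contraction.
by move=> f /= fU; rewrite -connection_tofrac stU.
Qed.

Lemma W1_submodule_rank (W : set V) : acts_irreducibly C ->
  W1_submodule a b C W -> (exists2 f, W f & f != 0) -> has_rank W n.
Proof.
move=> irr sW [f Wf f0].
have [_ WD WZ] := W1_submodule_poly sW; have [_ _ _ WA] := sW.
have [m [v [Wv vi Wspan]]] := frac_span W.
split; last by move=> k u _; apply: lin_indep_leq.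
pose X := [tuple tf (v i) | i < m].
have [|X0|XT] := irr <<X>>%VS.
- apply: connection_fderiv_span => i.
  rewrite -tnth_nth tnth_mktuple connection_tofrac.
  (* The factor x + b cannot be removed inside [W], but it can in the span over K(x). *)
  have : W (('X + b%:P) *: LC (v i)).
    have -> : ('X + b%:P) *: LC (v i) = act 1 (v i) + (- a)%:P *: v i.
      by rewrite /W1_act /= mul1r polyCN scaleNr addrK.
    by apply: WD; [apply: WA | apply: WZ].
  move/Wspan; rewrite map_mxZ => /(memvZ (tofrac ('X + b%:P))^-1).
  by rewrite scalerA mulVf ?scale1r // tofrac_eq0 XaddC_neq0.
- case/eqP: f0; apply: map_tofrac_inj; rewrite map_mx0.
  by have := Wspan f Wf; rewrite X0 memv0 => /eqP.
- have /lin_indep_free := vi; rewrite /free size_tuple XT dimvf /dim /= muln1.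
  by move=> /eqP e; subst m; exists v.
Qed.

(** For the converse, the contraction of a nonzero stable [U] has rank n, and n independent vectors
    in [U] span the whole space. *)
Lemma acts_irreducibly_rankP : acts_irreducibly C <->
  forall W : set V, W1_submodule a b C W -> (exists2 f, W f & f != 0) ->
    has_rank W n.
Proof.
split=> [irr W|rk U stU]; first exact: W1_submodule_rank.
have [->|/contraction_neq0 Un0] := eqVneq U 0%VS; [by left | right].
have [[v Uv vi] _] := rk _ (W1_submodule_contraction stU) Un0.
apply/eqP; rewrite eqEsubv subvf -(lin_indep_span_full vi); apply/span_subvP=> u.
by case/tnthP=> i ->; rewrite tnth_mktuple; apply: Uv.
Qed.

(** This is L_0 L_1 - L_{-1} L_2 - L_1. By [L, x + b] = 1 its terms in L^3 and L^2 cancel, leaving a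
    multiple of L. *)
Lemma W1_act_extract_connection f : act 1 (act 2 f) - ('X + b%:P) *: act 3 f - act 2 f =
  (2 * a * (a - 1))%:P *: LC f.
Proof.
have L1 g h (p q : P) : LC (p *: g + q *: h) =
    p^`() *: g + p *: LC g + (q^`() *: h + q *: LC h).
  have := connection_deriv_linear C 1 (p *: g) (q *: h).
  by rewrite !scale1r !connection_derivM.
rewrite /W1_act /= L1 !derivE; apply/matrixP=> i j; rewrite !mxE.
by rewrite !polyCM polyCB !polyC_natr; ring.
Qed.

(* For a = 1, the action of L_(k-1) is f |-> L^k ((x + b) f); otherwise L itself
   preserves W, as 2 a (a - 1) != 0. *)
Lemma iter_connection_W1_submodule (W : set V) f k : a != 0 ->
  W1_submodule a b C W -> W f -> W (iter k LC (('X + b%:P) *: f)).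
Proof.
move=> a0 sW Wf; have [W0 WD WZ] := W1_submodule_poly sW.
have [_ _ _ WA] := sW; have [a1|a1] := eqVneq a 1.
  by have := WA k f Wf; rewrite /W1_act a1 mulr1 polyC_natr -iter_connectionX.
have WL g : W g -> W (LC g).
  move=> Wg; have c0 : 2 * a * (a - 1) != 0.
    by rewrite !mulf_neq0 ?subr_eq0 // pnatr_eq0.
  have := WZ (2 * a * (a - 1))^-1%:P ((2 * a * (a - 1))%:P *: LC g).
  rewrite scalerA -polyCM mulVf // scale1r; apply; rewrite -W1_act_extract_connection.
  rewrite -!scaleN1r; apply: (WD); [apply: WD|]; last exact/WZ/WA.
    exact/WA/WA.
  exact/WZ/WZ/WA.
by elim: k => [|k] /=; [apply: WZ | apply: WL].
Qed.

Lemma W1_submodule_full (W : set V) : a != 0 -> acts_irreducibly C ->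
  W1_submodule a b C W -> (exists2 f, W f & f != 0) -> forall f, W f.
Proof.
move=> a0 irr sW [f0 Wf0 f0N0]; have [W0 WD WZ] := W1_submodule_poly sW.
(* the largest submodule of W stable under L *)
pose W' : set V := [set f | forall k, W (iter k LC f)]%classic.
suff W'T f : W' f by move=> f; apply: (W'T f 0%N).
have it0 k : iter k LC 0 = 0.
  have := iter_connection_linear C k (-1) 0 0.
  by rewrite scaler0 addr0 polyCN scaleN1r addNr.
have pW' : poly_submodule W'.
  apply: poly_submodule_of_X.
  - by move=> k; rewrite it0.
  - move=> g h Wg Wh k; have := iter_connection_linear C k 1 g h.
    by rewrite !scale1r => ->; apply: WD.
  - move=> c g Wg k; have := iter_connection_linear C k c g 0.
    by rewrite it0 !addr0 => ->; apply: WZ.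
  - move=> g Wg k; rewrite iter_connection_derivX.
    by apply: WD; apply: WZ; apply: Wg.
have LW' g : W' g -> W' (LC g) by move=> Wg k; rewrite -iterSr; apply: Wg.
(* Being L-stable, [W'] is again a W_1-submodule; it contains the nonzero vector (x + b) [f0], so
   its rank is n. *)
have [] := W1_submodule_rank irr (W1_submodule_stable pW' LW').
  exists (('X + b%:P) *: f0) => [k|]; first exact: iter_connection_W1_submodule.
  by rewrite scalemx_eq0 negb_or XaddC_neq0.
case=> v W'v vi _; have [p p0 pW] := poly_submodule_det pW' W'v vi.
exact: (stable_poly_submodule_full pW' LW' p0 pW).
Qed.

Lemma Vabc_irreducibleP : (0 < n)%N ->
  gcm_irreducible (Vabc a b C) <-> a != 0 /\ acts_irreducibly C.
Proof.
move=> n0; split=> [[_ irr]|[a0 irr]].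
  split.
    apply/eqP=> a0.
    (* For a = 0 the image of V under multiplication by x + b is a submodule. *)
    pose W : set V := [set f | exists g : V, f = ('X + b%:P) *: g]%classic.
    pose one : V := const_mx 1.
    have [|W0|WT] := irr W.
    - split=> [|_ _ [f ->] [g ->]|p _ [f ->]|_ k [f ->]].
      + by exists 0; rewrite scaler0.
      + by exists (f + g); rewrite scalerDr.
      + by exists (p *: f); rewrite !scalerA mulrC.
      (* With a = 0 only the term (x + b) L^k of the action remains. *)
      + rewrite /= /Vabc_act /W1_act a0 mulr0 polyC0 scale0r addr0.
        by eexists; rewrite scalerA mulrC -scalerA.
    - have : W (('X + b%:P) *: one) by exists one.
      rewrite W0 => /matrixP/(_ (Ordinal n0) 0)/eqP.
      by rewrite !mxE mulr1 (negPf XaddC_neq0).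
    (* Evaluation at x = -b kills every multiple of x + b, but sends the entries of [one] to 1. *)
    - have [g /matrixP/(_ (Ordinal n0) 0)] : W one by rewrite WT.
      rewrite !mxE => /(congr1 (horner^~ (- b))) /eqP.
      by rewrite hornerM !hornerE addNr mul0r oner_eq0.
  (* The contraction of a nonzero stable [U] is a nonzero submodule, hence everything. Each [u] is
     polynomial up to a denominator, so it lies in [U]. *)
  move=> U stU; have [->|/contraction_neq0[f fU f0]] := eqVneq U 0%VS; first by left.
  right; have /gcm_submoduleP/irr[W0|WT] := W1_submodule_contraction stU.
    by case/eqP: f0; have : [set f | tf f \in U]%classic f by []; rewrite W0.
  apply/eqP; rewrite eqEsubv subvf; apply/subvP=> u _.
  have [p p0 [g pg]] := frac_mx_common_denom u.
  have : tf g \in U by have : [set f | tf f \in U]%classic g by rewrite WT.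
  rewrite -pg => /(memvZ (tofrac p)^-1).
  by rewrite scalerA mulVf ?scale1r // tofrac_eq0.
split; first by exists (const_mx 1 : V); apply/eqP=> /matrixP/(_ (Ordinal n0) 0)/eqP;
  rewrite !mxE oner_eq0.
move=> W /gcm_submoduleP sW; have [W0|/existsNP[f /not_implyP[Wf f0]]] :=
  pselect (forall f, W f -> f = 0).
  left; apply/seteqP; split=> // _ ->.
  by have [] := W1_submodule_poly sW.
right; apply/seteqP; split=> // g _; apply: (W1_submodule_full a0 irr sW).
by exists f => //; apply/eqP.
Qed.

End VirasoroModule.

(** * Specialization to the complex numbers [R[i]] *)

Theorem theorem4p17 (R : realType) (n : nat) (n_gt0 : (0 < n)%N)
    (a b : R[i]) (C : 'M[{poly R[i]}]_n) :
  (gcm_irreducible (Vabc a b C) <-> a != 0 /\ acts_irreducibly C) /\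
  [<-> acts_irreducibly C;
       forall r : nat, (1 <= r < n)%N ->
         forall (B : 'M[{fraction {poly R[i]}}]_r)
                (Y : 'M[{fraction {poly R[i]}}]_(n, r)),
         map_mx (@fderiv R[i]) Y + map_mx (@tofrac _) C *m Y = Y *m B -> Y = 0;
       forall W : set 'cV[{poly R[i]}]_n,
         W1_submodule a b C W -> (exists2 f, W f & f != 0) -> has_rank W n].
Proof.
split; first exact: Vabc_irreducibleP.
tfae.
- by move/acts_irreducibly_mxP.
(* The passage from matrix equations to ranks goes through irreducibility of L. *)
- by move/acts_irreducibly_mxP/(acts_irreducibly_rankP a b).
- by move/acts_irreducibly_rankP.
Qed.
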